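(* Let $n \geq 2$. In the space of finitely presentable $n$-parameter persistence modules equipped with the interleaving distance, the indecomposable modules form a dense subset.
   Context: Fix a field $\mathbb{k}$ and let $\mathbf{vec}$ be the category of finite dimensional $\mathbb{k}$-vector spaces. $\mathbf{R}^n$ is the poset $\mathbb{R}^n$ with the product (componentwise) order, viewed as a category. An $n$-parameter persistence module is a functor $M : \mathbf{R}^n \to \mathbf{vec}$; morphisms are natural transformations. For $i \in \mathbf{R}^n$, let $\mathsf{P}_i : \mathbf{R}^n \to \mathbf{vec}$ be the functor with $\mathsf{P}_i(j) = \mathbb{k}$ if $i \leq j$ and $0$ otherwise, all structure morphisms not forced to be zero being the identity. A module is finitely presentable if it is isomorphic to the cokernel of a morphism $\bigoplus_{j \in J} \mathsf{P}_j \to \bigoplus_{i \in I} \mathsf{P}_i$ with $I, J$ finite multisets of elements of $\mathbf{R}^n$. A module is decomposable if it is isomorphic to $A \oplus B$ with $A, B$ both non-zero; it is indecomposable if it is non-zero and not decomposable. Interleavings: for $r \in \mathbb{R}$ and $s \in \mathbf{R}^n$, $s + r$ denotes $(s_1+r,\dots,s_n+r)$. The shift $M[r]$ is defined by $M[r](s) = M(s+r)$, with the corresponding structure morphisms (and similarly $f[r]$ for morphisms $f$). For $r \geq 0$, $\eta^M_r : M \to M[r]$ is the natural transformation given by the structure morphisms $M(a) \to M(a+r)$. For $\epsilon \geq 0$, an $\epsilon$-interleaving between $M$ and $N$ is a pair of morphisms $f : M \to N[\epsilon]$, $g : N \to M[\epsilon]$ with $g[\epsilon]\circ f = \eta^M_{2\epsilon}$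 and $f[\epsilon] \circ g = \eta^N_{2\epsilon}$. The interleaving distance is $d_I(M,N) = \inf\{\epsilon \geq 0 : M \text{ and } N \text{ are } \epsilon\text{-interleaved}\} \in [0,\infty]$. The space of finitely presentable $n$-parameter persistence modules is the set of isomorphism classes of finitely presentable modules $\mathbf{R}^n \to \mathbf{vec}$, with the topology generated by the open balls of $d_I$ (which is an extended metric on this set). *)

(* Defs.v *)
From HB Require Import structures.
From mathcomp Require Import all_boot all_order all_algebra.
From mathcomp Require Import all_classical all_reals all_analysis.

Set Implicit Arguments.
Unset Strict Implicit.
Unset Printing Implicit Defensive.

Import Order.TTheory GRing.Theory Num.Theory.
Import VectorInternalTheory.

Local Open Scope classical_set_scope.
Local Open Scope quotient_scope.
Local Open Scope ring_scope.

Section PersistenceModules.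
Variables (R : realType) (K : fieldType) (n : nat).

Local Notation pt := 'rV[R]_n.

Definition ple (s t : pt) : bool := [forall i, s ord0 i <= t ord0 i].

Lemma ple_refl s : ple s s.
Proof. exact/forallP. Qed.

Lemma ple_trans s t u : ple s t -> ple t u -> ple s u.
Proof.
move=> /forallP st /forallP tu; apply/forallP => i; exact: le_trans (st i) _.
Qed.

Definition psh (s : pt) (r : R) : pt := s + const_mx r.

Lemma ple_psh s t r : ple s t -> ple (psh s r) (psh t r).
Proof. by move=> /forallP st; apply/forallP => i; rewrite !mxE lerD2r. Qed.

Lemma ple_psh0 s r : 0 <= r -> ple s (psh s r).
Proof. by move=> r0; apply/forallP => i; rewrite !mxE lerDl. Qed.

Lemma pshD s r r' : psh (psh s r') r = psh s (r + r').
Proof. by apply/rowP => i; rewrite !mxE -addrA (addrC r'). Qed.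

Lemma ple_pshD s r r' : ple (psh (psh s r') r) (psh s (r + r')).
Proof. by rewrite pshD ple_refl. Qed.

Record pmod := PMod {
  pobj :> pt -> vectType K;
  smap : forall s t, ple s t -> 'Hom(pobj s, pobj t);
  smap_id : forall s (h : ple s s), smap h = \1%VF;
  smap_comp : forall s t u (h1 : ple s t) (h2 : ple t u) (h : ple s u),
    (smap h2 \o smap h1)%VF = smap h }.

Record mor (M N : pmod) := Mor {
  mcomp :> forall s, 'Hom(M s, N s);
  mor_nat : forall s t (h : ple s t),
    (mcomp t \o smap M h)%VF = (smap N h \o mcomp s)%VF }.

Lemma morP (M N : pmod) (f g : mor M N) : (forall s, f s = g s) -> f = g.
Proof.
case: f => f fn; case: g => g gn /= fg.
have {}fg : f = g by exact: functional_extensionality_dep.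
by rewrite fg in fn *; rewrite (Prop_irrelevance fn gn).
Qed.

Lemma mor_natE (M N : pmod) (f : mor M N) s t (h : ple s t) v :
  f t (smap M h v) = smap N h (f s v).
Proof. by move/lfunP: (mor_nat f h) => /(_ v); rewrite !comp_lfunE. Qed.

Lemma smap_idE (M : pmod) s (h : ple s s) v : smap M h v = v.
Proof. by rewrite smap_id id_lfunE. Qed.

Lemma smap_compE (M : pmod) s t u (h1 : ple s t) (h2 : ple t u) (h : ple s u) v :
  smap M h2 (smap M h1 v) = smap M h v.
Proof. by rewrite -(smap_comp M h1 h2 h) comp_lfunE. Qed.

Fact mor_id_nat (M : pmod) s t (h : ple s t) :
  (\1 \o smap M h)%VF = (smap M h \o \1)%VF.
Proof. by rewrite comp_lfun1l comp_lfun1r. Qed.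

Definition mor_id (M : pmod) : mor M M := Mor (@mor_id_nat M).

Fact mor_comp_nat (L M N : pmod) (g : mor M N) (f : mor L M) s t (h : ple s t) :
  ((g t \o f t) \o smap L h)%VF = (smap N h \o (g s \o f s))%VF.
Proof. by apply/lfunP => v; rewrite !comp_lfunE !mor_natE. Qed.

Definition mor_comp (L M N : pmod) (g : mor M N) (f : mor L M) : mor L N :=
  Mor (mor_comp_nat g f).

Fact mor_zero_nat (M N : pmod) s t (h : ple s t) :
  ((0 : 'Hom(M t, N t)) \o smap M h)%VF = (smap N h \o (0 : 'Hom(M s, N s)))%VF.
Proof. by apply/lfunP => v; rewrite !comp_lfunE !zero_lfunE linear0. Qed.

Definition mor_zero (M N : pmod) : mor M N := Mor (@mor_zero_nat M N).

Definition isomorphic (M N : pmod) : Prop :=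
  exists (f : mor M N) (g : mor N M),
    mor_comp g f = mor_id M /\ mor_comp f g = mor_id N.

Lemma mor_compA (A B C D : pmod) (h : mor C D) (g : mor B C) (f : mor A B) :
  mor_comp h (mor_comp g f) = mor_comp (mor_comp h g) f.
Proof. by apply: morP => s /=; rewrite comp_lfunA. Qed.

Lemma mor_comp1l (A B : pmod) (f : mor A B) : mor_comp (mor_id B) f = f.
Proof. by apply: morP => s /=; rewrite comp_lfun1l. Qed.

Lemma mor_comp1r (A B : pmod) (f : mor A B) : mor_comp f (mor_id A) = f.
Proof. by apply: morP => s /=; rewrite comp_lfun1r. Qed.

Lemma isomorphic_refl M : isomorphic M M.
Proof. by exists (mor_id M), (mor_id M); rewrite mor_comp1l. Qed.

Lemma isomorphic_sym M N : isomorphic M N -> isomorphic N M.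
Proof. by move=> [f [g [gf fg]]]; exists g, f. Qed.

Lemma isomorphic_trans M N L :
  isomorphic M N -> isomorphic N L -> isomorphic M L.
Proof.
move=> [f [g [gf fg]]] [f' [g' [gf' fg']]].
exists (mor_comp f' f), (mor_comp g g'); split.
  by rewrite mor_compA -(mor_compA g) gf' mor_comp1r.
by rewrite mor_compA -(mor_compA f') fg mor_comp1r.
Qed.

Fact zmod_id s (h : ple s s) : (0 : 'End('rV[K]_0)) = \1%VF.
Proof. by apply/lfunP => v; rewrite [LHS]thinmx0 [RHS]thinmx0. Qed.

Definition pzero : pmod :=
  @PMod (fun=> 'rV[K]_0) (fun _ _ _ => 0) zmod_id
    (fun _ _ _ _ _ _ => comp_lfun0l _ _).

Section DirectSum.
Variables M N : pmod.

Definition dsum_fun s t (h : ple s t) (v : M s * N s) : M t * N t :=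
  (smap M h v.1, smap N h v.2).

Fact dsum_fun_linear s t (h : ple s t) : linear (dsum_fun h).
Proof. by move=> a u v; rewrite /dsum_fun /= !linearP. Qed.

HB.instance Definition _ s t (h : ple s t) :=
  GRing.isLinear.Build K _ _ _ (dsum_fun h) (dsum_fun_linear h).

Fact dsum_id s (h : ple s s) : linfun (dsum_fun h) = \1%VF.
Proof.
apply/lfunP => -[v w]; rewrite lfunE id_lfunE /= /dsum_fun /=.
by rewrite !smap_idE.
Qed.

Fact dsum_comp s t u (h1 : ple s t) (h2 : ple t u) (h : ple s u) :
  (linfun (dsum_fun h2) \o linfun (dsum_fun h1))%VF = linfun (dsum_fun h).
Proof.
apply/lfunP => -[v w].
by rewrite comp_lfunE !lfunE /= /dsum_fun /= !(smap_compE _ _ h).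
Qed.

Definition dsum : pmod :=
  @PMod (fun s => (M s * N s)%type) (fun s t h => linfun (dsum_fun h))
    dsum_id dsum_comp.

End DirectSum.

(* The boolean [ple i s] is coerced to the dimension 1 or 0, so that the value
   of [pfree i] at [s] is K^1 if [i <= s] and K^0 otherwise. When both ends are
   K^1, the structure map is multiplication by the 1 x 1 matrix (1). *)
Section Free.
Variable i : pt.

Definition pfree_mx (s t : pt) : 'M[K]_(ple i s, ple i t) := const_mx 1.

Definition pfree_map (s t : pt) : 'Hom('rV[K]_(ple i s), 'rV[K]_(ple i t)) :=
  linfun (mulmxr (pfree_mx s t)).

Fact pfree_id s (h : ple s s) : pfree_map s s = \1%VF.
Proof.
apply/lfunP => v; rewrite lfunE id_lfunE /= /pfree_mx.
by case: (ple i s) v => v; [rewrite [const_mx 1]mx11_scalar mxE mulmx1|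
  rewrite [LHS]thinmx0 [RHS]thinmx0].
Qed.

Fact pfree_comp s t u (h1 : ple s t) (h2 : ple t u) (h : ple s u) :
  (pfree_map t u \o pfree_map s t)%VF = pfree_map s u.
Proof.
apply/lfunP => v; rewrite comp_lfunE !lfunE /= /pfree_mx -mulmxA.
have : ple i s -> ple i t by move=> /ple_trans; apply.
case: (ple i s) v => v; last by rewrite (thinmx0 v) !mul0mx.
move=> /(_ isT) ->; congr (_ *m _).
by rewrite [X in X *m _]mx11_scalar mxE mul1mx.
Qed.

Definition pfree : pmod :=
  @PMod (fun s => 'rV[K]_(ple i s))
    (fun s t _ => pfree_map s t) pfree_id pfree_comp.

End Free.

Definition dsum_free (I : seq pt) : pmod :=
  foldr (fun i M => dsum (pfree i) M) pzero I.

(* The quotient of [N s] by the image of [f s] is realized on a linear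
   complement of that image; [coker_proj f s] is the quotient map. *)
Section Cokernel.
Variables (M N : pmod) (f : mor M N).

Definition coker_sp s : {vspace N s} := ((limg (f s))^C)%VS.

Definition coker_proj_fun s (v : N s) : subvs_of (coker_sp s) :=
  vsproj (coker_sp s) (daddv_pi (coker_sp s) (limg (f s)) v).

Fact coker_proj_linear s : linear (@coker_proj_fun s).
Proof. by move=> a u v; rewrite /coker_proj_fun !linearP. Qed.

HB.instance Definition _ s :=
  GRing.isLinear.Build K _ _ _ (@coker_proj_fun s) (@coker_proj_linear s).

Fact coker_proj_im s u : coker_proj_fun (f s u) = 0.
Proof.
rewrite /coker_proj_fun; set v := f s u.
have cap : (limg (f s) :&: coker_sp s = 0)%VS by exact: capv_compl.
have cap' : (coker_sp s :&: limg (f s) = 0)%VS by rewrite capvC.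
have vin : v \in (coker_sp s + limg (f s))%VS.
  by rewrite /coker_sp addvC addv_complf memvf.
have := daddv_pi_add cap' vin.
rewrite [X in _ + X](daddv_pi_id cap) ?memv_img ?memvf //.
by rewrite -[RHS]add0r => /addIr ->; rewrite linear0.
Qed.

Fact coker_proj_lift s (v : N s) :
  exists u, vsval (coker_proj_fun v) = v - f s u.
Proof.
have cap' : (coker_sp s :&: limg (f s) = 0)%VS by rewrite capvC capv_compl.
have vin : v \in (coker_sp s + limg (f s))%VS.
  by rewrite /coker_sp addvC addv_complf memvf.
rewrite /coker_proj_fun vsprojK ?memv_pi //.
have := memv_pi (limg (f s)) (coker_sp s) v => /memv_imgP[u _ eu].
by exists u; rewrite -eu -{2}(daddv_pi_add cap' vin) addrK.
Qed.

Fact coker_proj_val s (w : subvs_of (coker_sp s)) :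
  coker_proj_fun (vsval w) = w.
Proof.
rewrite /coker_proj_fun daddv_pi_id ?vsvalK ?subvsP //.
by rewrite capvC capv_compl.
Qed.

Definition coker_smap s t (h : ple s t) :
    'Hom(subvs_of (coker_sp s), subvs_of (coker_sp t)) :=
  (linfun (@coker_proj_fun t) \o smap N h \o linfun vsval)%VF.

Fact coker_smap_proj s t (h : ple s t) v :
  coker_smap h (coker_proj_fun v) = coker_proj_fun (smap N h v).
Proof.
rewrite /coker_smap !comp_lfunE !lfunE /=.
have [u ->] := coker_proj_lift v.
by rewrite !linearB /= -mor_natE coker_proj_im subr0.
Qed.

Fact coker_id s (h : ple s s) : coker_smap h = \1%VF.
Proof.
apply/lfunP => w; rewrite id_lfunE -(coker_proj_val w).
by rewrite coker_smap_proj smap_idE.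
Qed.

Fact coker_comp s t u (h1 : ple s t) (h2 : ple t u) (h : ple s u) :
  (coker_smap h2 \o coker_smap h1)%VF = coker_smap h.
Proof.
apply/lfunP => w; rewrite comp_lfunE -(coker_proj_val w).
by rewrite !coker_smap_proj (smap_compE _ _ h).
Qed.

Definition coker : pmod :=
  @PMod (fun s => subvs_of (coker_sp s)) coker_smap coker_id coker_comp.

Fact coker_proj_nat s t (h : ple s t) :
  (linfun (@coker_proj_fun t) \o smap N h)%VF
  = (smap coker h \o linfun (@coker_proj_fun s))%VF.
Proof.
apply/lfunP => v; rewrite [LHS]comp_lfunE [RHS]comp_lfunE.
by rewrite [LHS]lfunE [X in smap coker h X]lfunE [RHS]coker_smap_proj.
Qed.

Definition coker_proj : mor N coker :=
  @Mor N coker (fun s => linfun (@coker_proj_fun s)) coker_proj_nat.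

Lemma coker_proj_comp0 : mor_comp coker_proj f = mor_zero M coker.
Proof.
apply: morP => s; apply/lfunP => u.
by rewrite /= comp_lfunE lfunE /= coker_proj_im zero_lfunE.
Qed.

Lemma coker_universal (L : pmod) (g : mor N L) :
  mor_comp g f = mor_zero M L -> exists! k : mor coker L, mor_comp k coker_proj = g.
Proof.
move=> gf0.
have gf s u : g s (f s u) = 0.
  have := congr1 (fun k : mor M L => k s u) gf0.
  by rewrite /= comp_lfunE zero_lfunE.
have gk s v : g s (vsval (coker_proj_fun v)) = g s v :> L s.
  by have [u ->] := coker_proj_lift v; rewrite linearB /= gf subr0.
have knat s t (h : ple s t) :
    ((g t \o linfun vsval) \o smap coker h)%VF
    = (smap L h \o (g s \o linfun vsval))%VF.
  apply/lfunP => w; rewrite -(coker_proj_val w) [LHS]comp_lfunE.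
  rewrite [X in (g t \o linfun vsval)%VF X]coker_smap_proj.
  by rewrite !comp_lfunE !lfunE /= !gk mor_natE.
exists (Mor knat); split.
  by apply: morP => s; apply/lfunP => v; rewrite /= !comp_lfunE !lfunE /= gk.
move=> k kE; apply: morP => s; apply/lfunP => w /=.
by rewrite -kE /= !comp_lfunE !lfunE /= coker_proj_val.
Qed.

End Cokernel.

Definition finitely_presentable (M : pmod) : Prop :=
  exists (J I : seq pt) (f : mor (dsum_free J) (dsum_free I)),
    isomorphic M (coker f).

Definition nonzero (M : pmod) : Prop := exists s, exists v : M s, v != 0.

Definition decomposable (M : pmod) : Prop :=
  exists A B : pmod, [/\ nonzero A, nonzero B & isomorphic M (dsum A B)].

Definition indecomposable (M : pmod) : Prop := nonzero M /\ ~ decomposable M.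

Definition shift (r : R) (M : pmod) : pmod :=
  @PMod (fun s => M (psh s r)) (fun s t h => smap M (ple_psh r h))
    (fun s h => smap_id _ _) (fun s t u h1 h2 h => smap_comp _ _ _ _).

Definition mor_shift (r : R) (M N : pmod) (f : mor M N) :
    mor (shift r M) (shift r N) :=
  @Mor (shift r M) (shift r N) (fun s => f (psh s r))
    (fun s t h => mor_nat f (ple_psh r h)).

Fact eta_nat (M : pmod) (r : R) (r0 : 0 <= r) s t (h : ple s t) :
  (smap M (ple_psh0 t r0) \o smap M h)%VF
  = (smap (shift r M) h \o smap M (ple_psh0 s r0))%VF.
Proof.
have h' := ple_trans h (ple_psh0 t r0).
by rewrite (smap_comp _ _ _ h') /= (smap_comp _ _ _ h').
Qed.

Definition eta (M : pmod) (r : R) (r0 : 0 <= r) : mor M (shift r M) :=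
  @Mor M (shift r M) (fun s => smap M (ple_psh0 s r0)) (eta_nat M r0).

(* The identification M[r][r'] = M[r + r'], i.e., the structure maps of M
   between the equal, but not convertible, points (s + r') + r and s + (r + r').
   It is needed to compare g[e] \o f : M -> M[e][e] with eta : M -> M[e + e]. *)
Fact shift_add_nat (M : pmod) (r r' : R) s t (h : ple s t) :
  (smap M (ple_pshD t r r') \o smap (shift r' (shift r M)) h)%VF
  = (smap (shift (r + r') M) h \o smap M (ple_pshD s r r'))%VF.
Proof.
have h' := ple_trans (ple_psh r (ple_psh r' h)) (ple_pshD t r r').
by rewrite /= (smap_comp _ _ _ h') (smap_comp _ _ _ h').
Qed.

Definition shift_add (M : pmod) (r r' : R) :
    mor (shift r' (shift r M)) (shift (r + r') M) :=
  @Mor (shift r' (shift r M)) (shift (r + r') M)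
    (fun s => smap M (ple_pshD s r r')) (@shift_add_nat M r r').

Definition interleaving (e : R) (e0 : 0 <= e) (M N : pmod)
    (f : mor M (shift e N)) (g : mor N (shift e M)) : Prop :=
  mor_comp (shift_add M e e) (mor_comp (mor_shift e g) f)
    = eta M (addr_ge0 e0 e0) /\
  mor_comp (shift_add N e e) (mor_comp (mor_shift e f) g)
    = eta N (addr_ge0 e0 e0).

Definition interleaved (e : R) (M N : pmod) : Prop :=
  exists (e0 : 0 <= e) (f : mor M (shift e N)) (g : mor N (shift e M)),
    interleaving e0 f g.

Definition dI (M N : pmod) : \bar R :=
  ereal_inf [set e%:E | e in [set e | interleaved e M N]].

Lemma interleaved_sym e M N : interleaved e M N -> interleaved e N M.
Proof. by move=> [e0 [f [g [gf fg]]]]; exists e0, g, f. Qed.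

Lemma interleaved_isol e M M' N :
  isomorphic M M' -> interleaved e M N -> interleaved e M' N.
Proof.
move=> [a [b [ba ab]]] [e0 [f [g [gf fg]]]].
have abE s v : a s (b s v) = v.
  by have := congr1 (fun k : mor M' M' => k s v) ab; rewrite /= comp_lfunE id_lfunE.
have baE s v : b s (a s v) = v.
  by have := congr1 (fun k : mor M M => k s v) ba; rewrite /= comp_lfunE id_lfunE.
exists e0, (mor_comp f b), (mor_comp (mor_shift e a) g); split.
  apply: morP => s; apply/lfunP => v.
  have := congr1 (fun k : mor M (shift (e + e) M) => k s (b s v)) gf.
  rewrite /= !comp_lfunE /= => E.
  by rewrite -mor_natE E mor_natE abE.
apply: morP => s; apply/lfunP => v.
have := congr1 (fun k : mor N (shift (e + e) N) => k s v) fg.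
by rewrite /= !comp_lfunE /= baE.
Qed.

Lemma dI_iso M M' N N' :
  isomorphic M M' -> isomorphic N N' -> dI M N = dI M' N'.
Proof.
move=> MM' NN'; congr ereal_inf; congr image.
apply/funext => e; apply/propext; split => E.
  apply: interleaved_isol MM' _; apply: interleaved_sym.
  by apply: interleaved_isol NN' _; apply: interleaved_sym.
apply: interleaved_isol (isomorphic_sym MM') _; apply: interleaved_sym.
by apply: interleaved_isol (isomorphic_sym NN') _; apply: interleaved_sym.
Qed.

(* [pmod] lies in the universe of [vectType K], which is too large for it to be
   a [choiceType]. The isomorphism classes are therefore formed on the modules
   whose values are the spaces K^d; [model] shows that every [pmod] is isomorphic
   to one of those. *)
Record kmod := KMod {
  kdim : pt -> nat;
  kmap : forall s t, ple s t -> 'Hom('rV[K]_(kdim s), 'rV[K]_(kdim t));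
  kmap_id : forall s (h : ple s s), kmap h = \1%VF;
  kmap_comp : forall s t u (h1 : ple s t) (h2 : ple t u) (h : ple s u),
    (kmap h2 \o kmap h1)%VF = kmap h }.

Definition pmod_of (M : kmod) : pmod :=
  @PMod (fun s => 'rV[K]_(kdim M s)) (@kmap M) (@kmap_id M) (@kmap_comp M).

Section Model.
Variable M : pmod.

Definition model_map s t (h : ple s t) :
    'Hom('rV[K]_(dim (M s)), 'rV[K]_(dim (M t))) :=
  (linfun v2r \o smap M h \o linfun r2v)%VF.

Fact model_mapE s t (h : ple s t) v : model_map h v = v2r (smap M h (r2v v)).
Proof. by rewrite /model_map !comp_lfunE !lfunE. Qed.

Fact model_id s (h : ple s s) : model_map h = \1%VF.
Proof. by apply/lfunP => v; rewrite model_mapE id_lfunE smap_idE r2vK. Qed.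

Fact model_comp s t u (h1 : ple s t) (h2 : ple t u) (h : ple s u) :
  (model_map h2 \o model_map h1)%VF = model_map h.
Proof.
by apply/lfunP => v; rewrite [LHS]comp_lfunE !model_mapE v2rK (smap_compE _ _ h).
Qed.

Definition model : kmod := KMod model_id model_comp.

Fact to_model_nat s t (h : ple s t) :
  (linfun v2r \o smap M h)%VF = (model_map h \o linfun v2r)%VF.
Proof.
apply/lfunP => v; rewrite [LHS]comp_lfunE [RHS]comp_lfunE model_mapE.
by rewrite !lfunE /= v2rK.
Qed.

Fact of_model_nat s t (h : ple s t) :
  (linfun r2v \o model_map h)%VF = (smap M h \o linfun r2v)%VF.
Proof.
apply/lfunP => v; rewrite [LHS]comp_lfunE [RHS]comp_lfunE model_mapE.
by rewrite !lfunE /= v2rK.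
Qed.

Lemma model_iso : isomorphic M (pmod_of model).
Proof.
exists (@Mor M (pmod_of model) (fun s => linfun v2r) to_model_nat).
exists (@Mor (pmod_of model) M (fun s => linfun r2v) of_model_nat).
split; apply: morP => s; apply/lfunP => v.
  by rewrite /= comp_lfunE id_lfunE !lfunE /= v2rK.
by rewrite /= comp_lfunE id_lfunE !lfunE /= r2vK.
Qed.

End Model.

Lemma finitely_presentable_iso M N :
  isomorphic M N -> finitely_presentable M -> finitely_presentable N.
Proof.
move=> MN [J [I [f Mf]]]; exists J, I, f.
exact: isomorphic_trans (isomorphic_sym MN) Mf.
Qed.

Record fpmod := FPMod {
  fp_kmod : kmod;
  fp_kmodP : finitely_presentable (pmod_of fp_kmod) }.

Coercion pmod_of_fpmod (M : fpmod) : pmod := pmod_of (fp_kmod M).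

HB.instance Definition _ := gen_eqMixin fpmod.
HB.instance Definition _ := gen_choiceMixin fpmod.

Definition fpiso (M N : fpmod) : bool := `[< isomorphic M N >].

Fact fpiso_refl : reflexive fpiso.
Proof. by move=> M; apply/asboolP; exact: isomorphic_refl. Qed.

Fact fpiso_sym : symmetric fpiso.
Proof. by move=> M N; apply/asboolP/asboolP; exact: isomorphic_sym. Qed.

Fact fpiso_trans : transitive fpiso.
Proof.
move=> M N L /asboolP NM /asboolP ML; apply/asboolP.
exact: isomorphic_trans NM ML.
Qed.

Canonical fpiso_equiv := EquivRel fpiso fpiso_refl fpiso_sym fpiso_trans.

Definition fpspace : Type := {eq_quot fpiso}.

HB.instance Definition _ := Choice.on fpspace.
HB.instance Definition _ := EqQuotient.on fpspace.

Definition fpclass (M : pmod) (hM : finitely_presentable M) : fpspace :=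
  \pi_fpspace (FPMod (finitely_presentable_iso (model_iso M) hM)).

Lemma fpclass_eq M N (hM : finitely_presentable M) (hN : finitely_presentable N) :
  fpclass hM = fpclass hN <-> isomorphic M N.
Proof.
split.
  move=> /eqmodP /asboolP /= MN.
  apply: isomorphic_trans (model_iso M) _; apply: isomorphic_trans MN _.
  exact: isomorphic_sym (model_iso N).
move=> MN; apply/eqmodP/asboolP.
apply: isomorphic_trans (isomorphic_sym (model_iso M)) _.
exact: isomorphic_trans MN (model_iso N).
Qed.

Lemma fpclass_surj (x : fpspace) :
  exists M (hM : finitely_presentable M), x = fpclass hM.
Proof.
exists (repr x), (fp_kmodP (repr x)); rewrite -[LHS]reprK.
by apply/eqmodP/asboolP; exact: model_iso.
Qed.

Definition fp_dist (x y : fpspace) : \bar R := dI (repr x) (repr y).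

Lemma fp_distE M N (hM : finitely_presentable M) (hN : finitely_presentable N) :
  fp_dist (fpclass hM) (fpclass hN) = dI M N.
Proof.
have rK L (hL : finitely_presentable L) : isomorphic (repr (fpclass hL)) L.
  apply: isomorphic_trans (isomorphic_sym (model_iso L)).
  by apply/asboolP; have /eqmodP := reprK (fpclass hL).
exact: dI_iso (rK _ hM) (rK _ hN).
Qed.

Definition fp_ball (x : fpspace) (r : R) : set fpspace :=
  [set y | (fp_dist x y < r%:E)%E].

HB.instance Definition _ := @isSubBaseTopological.Build fpspace (set fpspace)
  [set B | exists x r, 0 < r /\ B = fp_ball x r] id.

Definition fp_indecomposable : set fpspace :=
  [set x | exists M (hM : finitely_presentable M),
    indecomposable M /\ x = fpclass hM].

End PersistenceModules.

(* Main.v *)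
(* Let M have generators e_g and relations r_k, and fix e > 0. First move each
   r_k up by (e, ..., e) and each e_g up by some t_g in [0, e) such that the first
   coordinates a_g of the new degrees are distinct. Every relation involving e_g
   then has first coordinate larger than a_g, so on the hyperplane x_0 = a_g the
   generator e_g is independent of the others, arbitrarily far in the remaining
   directions. Add a generator h at (lo, hi, ..., hi), with lo very small and hi
   very large, which dies after a shift by e, and for each g a bridge w_g at
   (a_g - e, hi - delta_g, hi, ..., hi) with the relation w_g = e_g + h at
   (a_g, hi, ..., hi). The result N is e-interleaved with M.
   With delta_g increasing in a_g, the bridges are pairwise incomparable, so an
   endomorphism of N multiplies h by a scalar c, maps e_g to c_g e_g and w_g to
   c'_g w_g modulo generators e_g' with a_g' < a_g, and the relation of w_g forces
   c_g = c'_g = c. If it is idempotent and c = 0, it is nilpotent, hence 0.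
   The two projections of a decomposition of N have scalars with product 0,
   so one of the summands vanishes. *)

From HB Require Import structures.
Require Import Defs.
From mathcomp Require Import all_boot all_order all_algebra.
From mathcomp Require Import all_classical all_reals all_analysis.
From mathcomp Require Import finmap lra.

Set Implicit Arguments.
Unset Strict Implicit.
Unset Printing Implicit Defensive.

Import Order.TTheory GRing.Theory Num.Theory.

Local Open Scope classical_set_scope.
Local Open Scope ring_scope.

(** * Presentations by generators and relations *)

Section Presentations.
Variables (R : realType) (K : fieldType) (n : nat).
Local Notation pt := 'rV[R]_n.
Local Notation pmod := (pmod R K n).

(* Generators are encoded as sections [x g] over all points. Only the values
   [x g s] with [d g <= s] matter, the others are arbitrary. *)
Record presents (G Q : finType) (d : G -> pt) (q : Q -> pt) (A : Q -> G -> K)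
    (X : pmod) (x : forall (g : G) (s : pt), X s) : Prop := Presents {
  pres_deg : forall k g, A k g != 0 -> ple (d g) (q k);
  pres_smap : forall g s t (h : ple s t),
    ple (d g) s -> smap X h (x g s) = x g t;
  pres_gen : forall s (v : X s),
    exists c : G -> K, v = \sum_(g | ple (d g) s) c g *: x g s;
  pres_rel : forall k s, ple (q k) s -> \sum_g A k g *: x g s = 0;
  pres_syz : forall s (c : G -> K),
    \sum_(g | ple (d g) s) c g *: x g s = 0 ->
    exists b : Q -> K, forall g, ple (d g) s ->
      c g = \sum_(k | ple (q k) s) b k * A k g }.

Lemma sum_supp (G : finType) (P : pred G) (V : lmodType K) (c : G -> K)
    (y : G -> V) :
  (forall g, c g != 0 -> P g) -> \sum_(g | P g) c g *: y g = \sum_g c g *: y g.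
Proof.
move=> cP; rewrite [RHS](bigID P) /= [X in _ = _ + X]big1 ?addr0 // => g gP.
case: (eqVneq (c g) 0) => [->|/cP gP']; first by rewrite scale0r.
by rewrite gP' in gP.
Qed.

Lemma sum_deg (G Q : finType) (d : G -> pt) (q : Q -> pt) (A : Q -> G -> K)
    (V : lmodType K) (y : G -> V) k s :
  (forall k g, A k g != 0 -> ple (d g) (q k)) -> ple (q k) s ->
  \sum_(g | ple (d g) s) A k g *: y g = \sum_g A k g *: y g.
Proof. by move=> deg ks; apply: sum_supp => g /deg /ple_trans; apply. Qed.

Lemma mor_of_linear (X Y : pmod) (F : forall s, X s -> Y s) :
  (forall s, linear (F s)) ->
  (forall s t (h : ple s t) v, F t (smap X h v) = smap Y h (F s v)) ->
  exists f : mor X Y, forall s v, f s v = F s v.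
Proof.
move=> F_lin F_nat.
pose isL s := GRing.isLinear.Build K _ _ _ (F s) (F_lin s).
pose FL s : {linear X s -> Y s} := HB.pack (F s) (isL s).
pose f s : 'Hom(X s, Y s) := linfun (FL s).
have fE s v : f s v = F s v by rewrite lfunE.
have fnat s t (h : ple s t) : (f t \o smap X h)%VF = (smap Y h \o f s)%VF.
  by apply/lfunP => v; rewrite !comp_lfunE !fE F_nat.
by exists (Mor fnat).
Qed.

(** * Morphisms out of a presented module *)

Section Hom.
Variables (G Q : finType) (d : G -> pt) (q : Q -> pt) (A : Q -> G -> K).
Variables (X : pmod) (x : forall (g : G) (s : pt), X s).
Hypothesis P : presents d q A x.

Lemma pres_eq (Y : pmod) (f f' : mor X Y) :
  (forall g s, ple (d g) s -> f s (x g s) = f' s (x g s)) ->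
  forall s v, f s v = f' s v.
Proof.
move=> E s v; have [c ->] := pres_gen P v.
by rewrite !linear_sum; apply: eq_bigr => g gs; rewrite !linearZ /= E.
Qed.

(** Sending [v] to the same combination of the [y g s] is well defined: by [pres_syz] two choices of
    coefficients differ by a combination of relations, and [yrel] kills those. *)
Lemma pres_hom (Y : pmod) (y : forall (g : G) (s : pt), Y s) :
  (forall g s t (h : ple s t), ple (d g) s -> smap Y h (y g s) = y g t) ->
  (forall k s, ple (q k) s -> \sum_g A k g *: y g s = 0) ->
  exists f : mor X Y, forall g s, ple (d g) s -> f s (x g s) = y g s.
Proof.
move=> ysmap yrel.
pose ev s (c : G -> K) := \sum_(g | ple (d g) s) c g *: y g s.
pose cf s v := projT1 (cid (pres_gen P (v : X s))).
have cfE s v : v = \sum_(g | ple (d g) s) cf s v g *: x g s.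
  exact: (projT2 (cid (pres_gen P v))).
have ev0 s c : \sum_(g | ple (d g) s) c g *: x g s = 0 -> ev s c = 0.
  move=> /(pres_syz P)[b bE]; rewrite /ev.
  under eq_bigr => g gs do rewrite bE // scaler_suml.
  rewrite exchange_big big1 //= => k ks.
  under eq_bigr => g _ do rewrite -scalerA.
  by rewrite -scaler_sumr (sum_deg _ (pres_deg P)) // yrel // scaler0.
have evE s c : ev s (cf s (\sum_(g | ple (d g) s) c g *: x g s)) = ev s c.
  apply/eqP; rewrite -subr_eq0 /ev -sumrB; apply/eqP.
  under eq_bigr do rewrite -scalerBl.
  apply: (ev0 s (fun g => cf s _ g - c g)).
  by under eq_bigr do rewrite scalerBl; rewrite sumrB -cfE subrr.
pose F s v := ev s (cf s v).
have F_lin s : linear (F s).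
  move=> a u v; rewrite /F {1}(cfE s u) {1}(cfE s v) scaler_sumr -big_split /=.
  under eq_bigr do rewrite scalerA -scalerDl.
  rewrite evE /ev scaler_sumr -big_split; apply: eq_bigr => g _ /=.
  by rewrite scalerDl scalerA.
have Fx g s : ple (d g) s -> F s (x g s) = y g s.
  move=> gs; rewrite /F.
  have sumd V (z : G -> V : lmodType K) :
      \sum_(g' | ple (d g') s) (g' == g)%:R *: z g' = z g.
    rewrite (bigD1 g) //= eqxx scale1r big1 ?addr0 // => g' /andP[_ /negPf ->].
    by rewrite scale0r.
  by rewrite -[x g s](sumd (X s) (x^~ s)) evE /ev sumd.
have F_nat s t (h : ple s t) v : F t (smap X h v) = smap Y h (F s v).
  pose FL : {linear X t -> Y t} :=
    HB.pack (F t) (GRing.isLinear.Build K _ _ _ (F t) (F_lin t)).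
  rewrite [v]cfE [F s _]evE /ev !linear_sum -[F t _]/(FL _) linear_sum.
  apply: eq_bigr => g gs; rewrite !linearZ /= (pres_smap P) //.
  by rewrite Fx ?ysmap // (ple_trans gs h).
have [f fE] := mor_of_linear F_lin F_nat.
by exists f => g s gs; rewrite fE Fx.
Qed.

(* The coefficients are indexed by all pairs of generators, vanishing unless the
   degrees are comparable, so that the same sum is valid at every point. *)
Lemma pres_endo (f : mor X X) : exists C : G -> G -> K,
  (forall g g', C g g' != 0 -> ple (d g') (d g)) /\
  (forall g s, ple (d g) s -> f s (x g s) = \sum_g' C g g' *: x g' s).
Proof.
pose c g := projT1 (cid (pres_gen P (f (d g) (x g (d g))))).
have cE g : f (d g) (x g (d g)) =
    \sum_(g' | ple (d g') (d g)) c g g' *: x g' (d g).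
  exact: (projT2 (cid (pres_gen P (f (d g) (x g (d g)))))).
pose C g g' := if ple (d g') (d g) then c g g' else 0.
have CP g g' : C g g' != 0 -> ple (d g') (d g).
  by rewrite /C; case: ifP; rewrite ?eqxx.
exists C; split=> // g s gs.
rewrite -(pres_smap P gs (ple_refl _)) mor_natE cE linear_sum.
rewrite -(sum_supp _ (CP g)); apply: eq_bigr => g' g'g.
by rewrite linearZ /= (pres_smap P) // /C g'g.
Qed.

Lemma presents_iso (Y : pmod) (f : mor X Y) (g : mor Y X) :
  mor_comp g f = mor_id X -> mor_comp f g = mor_id Y ->
  presents d q A (fun g s => f s (x g s)).
Proof.
move=> gf fg.
have fK s v : g s (f s v) = v.
  by have := congr1 (fun k : mor X X => k s v) gf; rewrite /= comp_lfunE id_lfunE.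
have gK s v : f s (g s v) = v.
  by have := congr1 (fun k : mor Y Y => k s v) fg; rewrite /= comp_lfunE id_lfunE.
split.
- exact: pres_deg P.
- by move=> i s t h ds; rewrite -mor_natE (pres_smap P).
- move=> s v; have [c cE] := pres_gen P (g s v); exists c.
  by rewrite -[LHS]gK cE linear_sum; apply: eq_bigr => i _; rewrite linearZ.
- move=> k s ks; under eq_bigr do rewrite -linearZ.
  by rewrite -linear_sum /= (pres_rel P) // linear0.
- move=> s c E; apply: (pres_syz P).
  rewrite -[LHS]fK linear_sum -[RHS](linear0 (g s)) -[in RHS]E.
  by congr (g s _); apply: eq_bigr => i _; rewrite linearZ.
Qed.

End Hom.

(** * Free modules and cokernels *)

Definition norel : void -> pt := of_void pt.
Definition norelA (G : finType) : void -> G -> K := of_void (G -> K).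

Lemma dsum_smapE (M N : pmod) s t (h : ple s t) v :
  smap (dsum M N) h v = (smap M h v.1, smap N h v.2).
Proof. by rewrite /= lfunE. Qed.

Lemma pfree_smap1 (i s t : pt) (h : ple s t) : ple i s ->
  smap (pfree K i) h (const_mx 1) = const_mx 1.
Proof.
move=> si; rewrite /= lfunE /= /pfree_mx; move: (ple_trans si h).
case: (ple i s) si => // _; case: (ple i t) => // _.
by rewrite [X in X *m _]mx11_scalar mxE mul1mx.
Qed.

(** Stated for sequences to allow induction along the sum. The head contributes the section [(1, 0)]
    and the tail the sections [(0, x g)]; [uniq r] ensures that the test [g == g0] tells them
    apart. *)
Lemma dsum_free_seq (G : eqType) (d : G -> pt) (r : seq G) : uniq r ->
  exists x : forall (g : G) (s : pt), dsum_free K [seq d g | g <- r] s,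
  [/\ forall g s t (h : ple s t), g \in r -> ple (d g) s ->
        smap _ h (x g s) = x g t,
      forall s (v : dsum_free K [seq d g | g <- r] s),
        exists c : G -> K, v = \sum_(g <- r | ple (d g) s) c g *: x g s &
      forall s (c : G -> K), \sum_(g <- r | ple (d g) s) c g *: x g s = 0 ->
        forall g, g \in r -> ple (d g) s -> c g = 0].
Proof.
elim: r => [_|g0 r IH /= /andP[g0r /IH[x [xs xg xi]]]].
  exists (fun _ _ => 0); split=> //= s v.
  by exists (fun=> 0); rewrite big_nil; apply/thinmx0.
pose V s : lmodType K := dsum_free K [seq d g | g <- g0 :: r] s.
pose x0 g s : V s := if g == g0 then (const_mx 1, 0) else (0, x g s).
have g0E g : g \in r -> (g == g0) = false.
  by move=> gr; apply: contraNF g0r => /eqP <-.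
have sumE s c : \sum_(g <- g0 :: r | ple (d g) s) c g *: x0 g s =
    (((c g0 * (ple (d g0) s)%:R) *: const_mx 1,
     \sum_(g <- r | ple (d g) s) c g *: x g s) : V s).
  have -> : \sum_(g <- g0 :: r | ple (d g) s) c g *: x0 g s =
     (c g0 * (ple (d g0) s)%:R) *: x0 g0 s +
     \sum_(g <- r | ple (d g) s) c g *: x0 g s.
    by rewrite big_cons; case: ifP; rewrite ?mulr1 // mulr0 scale0r add0r.
  have -> : \sum_(g <- r | ple (d g) s) c g *: x0 g s =
     ((0, \sum_(g <- r | ple (d g) s) c g *: x g s) : V s).
    rewrite (big_morph (fun v => (0, v) : V s) (id1 := 0) (op1 := +%R)) //.
      rewrite [LHS]big_seq_cond [RHS]big_seq_cond.
      apply: eq_bigr => g /andP[gr _]; rewrite /x0 g0E //.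
      by congr pair; rewrite scaler0.
    by move=> u v; congr pair; rewrite addr0.
  by rewrite /x0 eqxx; congr pair; rewrite /= ?scaler0 ?add0r ?addr0.
exists x0; split.
- move=> g s t h; pose M := pfree K (d g0); pose N := dsum_free K [seq d g | g <- r].
  rewrite inE /x0; case: eqVneq => /= [-> _|_ gr] gs.
    apply: etrans (@dsum_smapE M N s t h (const_mx 1, 0)) _.
    by congr pair; rewrite /= ?linear0 //; apply: pfree_smap1.
  apply: etrans (@dsum_smapE M N s t h (0, x g s)) _.
  by congr pair; [exact: linear0 | exact: xs].
- move=> s [v w]; have [c cE] := xg s w.
  (* The row [v] has length 1 or 0, so the sum is its only entry or 0. *)
  exists (fun g => if g == g0 then \sum_j v 0 j else c g).
  rewrite sumE eqxx; congr pair.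
    case: (ple (d g0) s) v => v; last by rewrite [LHS]thinmx0 [RHS]thinmx0.
    by apply/rowP => j; rewrite big_ord_recl big_ord0 addr0 !mxE mulr1 mulr1 (ord1 j).
  rewrite cE [LHS]big_seq_cond [RHS]big_seq_cond.
  by apply: eq_bigr => g /andP[gr _]; rewrite g0E.
- move=> s c; rewrite sumE => -[E1 E2] g; rewrite inE => /orP[/eqP ->|gr] gs.
    move: E1; case: (ple (d g0) s) gs => // _ /rowP/(_ ord0).
    by rewrite !mxE !mulr1.
  exact: xi E2 _ gr gs.
Qed.

(** With no relations, [pres_syz] is linear independence: the sections form a basis at every
    point. *)
Lemma dsum_free_presents (G : finType) (d : G -> pt) :
  exists x : forall (g : G) (s : pt), dsum_free K [seq d g | g <- enum G] s,
    presents d norel (@norelA G) x.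
Proof.
have [x [xs xg xi]] := dsum_free_seq d (enum_uniq G).
exists x; split => //.
- by move=> g s t h; apply: xs; rewrite mem_enum.
- by move=> s v; have [c] := xg s v; rewrite big_enum_cond; exists c.
- move=> s c E; exists (fun=> 0) => g gs; rewrite big1; last by case.
  by apply: xi gs; rewrite ?mem_enum // big_enum_cond.
Qed.

(** A combination of the [y g s] that vanishes in the cokernel is some [f s u]. Expanding [u] in the
    [x k s] and comparing coefficients in the basis [y g s] gives the syzygy. *)
Lemma coker_presents (G Q : finType) (d : G -> pt) (q : Q -> pt)
    (A : Q -> G -> K) (X Y : pmod) (x : forall (k : Q) (s : pt), X s)
    (y : forall (g : G) (s : pt), Y s) (f : mor X Y) :
  presents q norel (@norelA Q) x -> presents d norel (@norelA G) y ->
  (forall k g, A k g != 0 -> ple (d g) (q k)) ->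
  (forall k s, ple (q k) s -> f s (x k s) = \sum_g A k g *: y g s) ->
  presents d q A (fun g s => coker_proj f s (y g s)).
Proof.
move=> Px Py deg fx; split => //.
- by move=> g s t h gs; rewrite -mor_natE (pres_smap Py).
- move=> s w; have [c cE] := pres_gen Py (vsval w); exists c.
  rewrite -[LHS](coker_proj_val w) cE.
  by rewrite linear_sum; apply: eq_bigr => g _; rewrite linearZ /= lfunE.
- move=> k s ks; under eq_bigr do rewrite -linearZ.
  by rewrite -linear_sum /= -fx // lfunE /= coker_proj_im.
- move=> s c E.
  have {}E : coker_proj_fun f (\sum_(g | ple (d g) s) c g *: y g s) = 0.
    rewrite -[RHS]E linear_sum.
    by apply: eq_bigr => g _; rewrite linearZ /= lfunE.
  have [u] := coker_proj_lift f (\sum_(g | ple (d g) s) c g *: y g s).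
  have [b ->] := pres_gen Px u.
  rewrite E linear0 => /esym/eqP; rewrite subr_eq0 => /eqP {}E.
  exists b => g gs; apply/eqP; rewrite -subr_eq0; apply/eqP.
  have E' : \sum_(g | ple (d g) s)
      (c g - \sum_(k | ple (q k) s) b k * A k g) *: y g s = 0.
    under eq_bigr do rewrite scalerBl scaler_suml.
    rewrite sumrB E exchange_big linear_sum -sumrB big1 //= => k ks.
    rewrite linearZ /= fx // -(sum_deg _ deg ks) scaler_sumr -sumrB big1 // => i _.
    by rewrite scalerA subrr.
  have [b' /(_ g gs) ->] := pres_syz Py E'.
  by rewrite big1 //; case.
Qed.

Lemma finitely_presentable_presents (M : pmod) : finitely_presentable M ->
  exists (G Q : finType) (d : G -> pt) (q : Q -> pt) (A : Q -> G -> K)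
    (x : forall (g : G) (s : pt), M s), presents d q A x.
Proof.
have enumI (I : seq pt) : exists m (d : 'I_m -> pt), I = [seq d i | i <- enum 'I_m].
  exists (size I), (fun i => nth 0 I i); apply: (@eq_from_nth _ 0).
    by rewrite size_map size_enum_ord.
  move=> i lti; rewrite (nth_map (Ordinal lti)) ?size_enum_ord //.
  by rewrite nth_enum_ord.
move=> [J [I [f [a [b [ba ab]]]]]].
have [p [q Jq]] := enumI J; have [m [d Id]] := enumI I; subst J I.
have [x Px] := dsum_free_presents q; have [y Py] := dsum_free_presents d.
pose c k := projT1 (cid (pres_gen Py (f (q k) (x k (q k))))).
have cE k : f (q k) (x k (q k)) = \sum_(g | ple (d g) (q k)) c k g *: y g (q k).
  exact: (projT2 (cid (pres_gen Py (f (q k) (x k (q k)))))).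
(* Row [k] holds the coordinates of the image of the [k]-th free generator at its own degree. The
   expansion leaves entries with [d g] not below [q k] arbitrary; [pres_deg] requires them to be
   0. *)
pose A k g := if ple (d g) (q k) then c k g else 0.
have deg k g : A k g != 0 -> ple (d g) (q k).
  by rewrite /A; case: ifP; rewrite ?eqxx.
have fx k s (ks : ple (q k) s) : f s (x k s) = \sum_g A k g *: y g s.
  rewrite -(pres_smap Px (s := q k) ks) ?ple_refl // mor_natE cE linear_sum.
  rewrite -(sum_deg _ deg (ple_refl (q k))); apply: eq_bigr => g gs.
  by rewrite linearZ /= (pres_smap Py) // /A gs.
have Pc := coker_presents Px Py deg fx.
by exists 'I_m, 'I_p, d, q, A; eexists; apply: (presents_iso Pc ab ba).
Qed.

(** The source of the map being free, [pres_hom] realizes any matrix with compatible degrees; its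
    cokernel is the module. *)
Lemma presentation_exists (G Q : finType) (d : G -> pt) (q : Q -> pt)
    (A : Q -> G -> K) :
  (forall k g, A k g != 0 -> ple (d g) (q k)) ->
  exists (N : pmod) (x : forall (g : G) (s : pt), N s),
    finitely_presentable N /\ presents d q A x.
Proof.
move=> deg; have [x Px] := dsum_free_presents q.
have [y Py] := dsum_free_presents d.
have [||f fE] := pres_hom Px (y := fun k s => \sum_g A k g *: y g s).
- move=> k s t h ks.
  rewrite -!(sum_deg _ deg ks) linear_sum.
  by apply: eq_bigr => g gs; rewrite linearZ /= (pres_smap Py).
- by case.
exists (coker f), (fun g s => coker_proj f s (y g s)); split.
  by exists [seq q k | k <- enum Q], [seq d g | g <- enum G], f; apply: isomorphic_refl.
exact: coker_presents Px Py deg fE.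
Qed.

End Presentations.

(** * Interleavings and open sets *)

Section Distance.
Variables (R : realType) (K : fieldType) (n : nat).
Local Notation pmod := (pmod R K n).
Local Notation shift := Defs.shift.

Lemma ple_psh2 (s : 'rV[R]_n) e e' : 0 <= e -> 0 <= e' -> ple s (psh (psh s e) e').
Proof. by move=> e0 e'0; rewrite pshD ple_psh0 // addr_ge0. Qed.

(** Moving the target from [s + (e + e)] to the equal point [(s + e) + e] removes [shift_add] from
    all later computations. *)
Lemma eta_compP (e : R) (e0 : 0 <= e) (M N : pmod) (f : mor M (shift e N))
    (g : mor N (shift e M)) :
  mor_comp (shift_add M e e) (mor_comp (mor_shift e g) f)
    = eta M (addr_ge0 e0 e0) <->
  forall s v, g (psh s e) (f s v) = smap M (ple_psh2 s e0 e0) v.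
Proof.
split=> [E s v|E].
  have := congr1 (fun k : mor M (shift (e + e) M) => k s v) E.
  rewrite /= !comp_lfunE /=.
  have h : ple (psh s (e + e)) (psh (psh s e) e) by rewrite pshD ple_refl.
  move=> /(congr1 (smap M h)).
  rewrite (smap_compE _ _ (ple_refl _)) smap_idE => ->.
  exact: smap_compE.
apply: morP => s; apply/lfunP => v.
by rewrite /= !comp_lfunE /= E; apply: smap_compE.
Qed.

Section Composition.
Variables (e e' E : R) (eE : e + e' = E) (L M N : pmod).

Fact psh_add_ple (s : 'rV[R]_n) : ple (psh (psh s e) e') (psh s E).
Proof. by rewrite pshD addrC eE ple_refl. Qed.

(** The total shift [E] is a variable tied to [e + e'] by an equation, so that the composites in
    both directions, with shifts [e + e'] and [e' + e], land in the same shift. *)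
Definition shift_comp_fun (f : mor L (shift e M)) (f' : mor M (shift e' N)) s :
    'Hom(L s, shift E N s) :=
  (smap N (psh_add_ple s) \o (f' (psh s e) \o f s))%VF.

Fact shift_comp_nat f f' s t (h : ple s t) :
  (shift_comp_fun f f' t \o smap L h)%VF
  = (smap (shift E N) h \o shift_comp_fun f f' s)%VF.
Proof.
have h' := ple_trans (ple_psh e' (ple_psh e h)) (psh_add_ple t).
apply/lfunP => v; rewrite /shift_comp_fun !comp_lfunE (mor_natE f h) /=.
by rewrite (mor_natE f' (ple_psh e h)) /= !(smap_compE _ _ h').
Qed.

Definition shift_comp f f' : mor L (shift E N) := Mor (shift_comp_nat f f').

End Composition.

(** The inner pair [f'], [g'] collapses first; naturality of [g] moves the resulting structure map
    outward, and then the pair [f], [g] collapses. *)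
Lemma eta_comp_trans (e e' E : R) (eE : e + e' = E) (eE' : e' + e = E)
    (L M N : pmod) (e0 : 0 <= e) (e'0 : 0 <= e') (E0 : 0 <= E)
    (f : mor L (shift e M)) (g : mor M (shift e L))
    (f' : mor M (shift e' N)) (g' : mor N (shift e' M)) :
  (forall s v, g (psh s e) (f s v) = smap L (ple_psh2 s e0 e0) v) ->
  (forall s v, g' (psh s e') (f' s v) = smap M (ple_psh2 s e'0 e'0) v) ->
  forall s v, shift_comp eE' g' g (psh s E) (shift_comp eE f f' s v)
    = smap L (ple_psh2 s E0 E0) v.
Proof.
move=> gf gf' s v; rewrite /= !comp_lfunE.
rewrite (mor_natE g' (psh_add_ple eE s)) gf' /=.
have h : ple (psh s e) (psh (psh s E) e').
  apply: ple_trans (ple_psh2 _ e'0 e'0) (ple_psh e' (psh_add_ple eE s)).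
rewrite (smap_compE _ _ h) (mor_natE g h) gf /=.
have h2 : ple s (psh (psh (psh s E) e') e).
  exact: ple_trans (ple_psh2 _ e0 e0) (ple_psh e h).
by rewrite (smap_compE _ _ h2); apply: smap_compE.
Qed.

Lemma interleaved_trans e e' (L M N : pmod) :
  interleaved e L M -> interleaved e' M N -> interleaved (e + e') L N.
Proof.
move=> [e0 [f [g [gf fg]]]] [e'0 [f' [g' [gf' fg']]]].
exists (addr_ge0 e0 e'0), (shift_comp erefl f f'), (shift_comp (addrC e' e) g' g).
move: gf fg gf' fg' => /eta_compP gf /eta_compP fg /eta_compP gf' /eta_compP fg'.
by split; apply/eta_compP; apply: eta_comp_trans.
Qed.

Lemma dI_le e (M N : pmod) : interleaved e M N -> (dI M N <= e%:E)%E.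
Proof. by move=> MN; apply: ereal_inf_lbound; exists e. Qed.

Lemma fp_open_ball (O : set (fpspace R K n)) (M : pmod)
    (hM : finitely_presentable M) : open O -> O (fpclass hM) ->
  exists2 e : R, 0 < e & forall (N : pmod) (hN : finitely_presentable N),
    interleaved e M N -> O (fpclass hN).
Proof.
(* In the topology generated by balls, [O] is a union of sets in [B], and the member [U] through the
   class of [M] is the intersection of a finite family [D] of balls. *)
move=> [B sB <-] [U BU UM].
have [D sD DU] := sB U BU.
(* Quantifying over all [e' <= e] makes [good] stable under shrinking [e], so the minimum over [D]
   works for every ball. *)
pose good (i : set (fpspace R K n)) (e : R) :=
  forall e' (N : pmod) (hN : finitely_presentable N),
    e' <= e -> interleaved e' M N -> i (fpclass hN).
have near (i : set (fpspace R K n)) : i \in D -> exists2 e : R, 0 < e & good i e.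
  move=> iD; have : i (fpclass hM) by move: UM; rewrite -DU => /(_ i iD).
  have /set_mem[x [r [r0 ->]]] := sD i iD.
  have [L [hL ->]] := fpclass_surj x.
  rewrite /fp_ball /= fp_distE => /ereal_inf_lt[_ [d LM <-]].
  (* Half of the gap keeps [d + e'] strictly below the radius [r]. *)
  rewrite lte_fin => dr; exists ((r - d) / 2); first by lra.
  move=> e' N hN e'r MN; rewrite /= fp_distE.
  apply: le_lt_trans (dI_le (interleaved_trans LM MN)) _.
  by rewrite lte_fin; lra.
have [e e0 eP] : exists2 e : R, 0 < e & forall i, i \in enum_fset D -> good i e.
  have : forall i, i \in enum_fset D -> exists2 e : R, 0 < e & good i e := near.
  elim: (enum_fset D) => [_|i r IH H]; first by exists 1.
  have [|e e0 eP] := IH; first by move=> j jr; apply: H; rewrite inE jr orbT.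
  have [|e' e'0 e'P] := H i; first by rewrite inE eqxx.
  exists (Num.min e e'); first by rewrite lt_min e0.
  move=> j; rewrite inE => /orP[/eqP ->|jr] d N hN; rewrite le_min => /andP[de de'].
    exact: e'P.
  exact: eP.
exists e => // N hN MN.
have UN : (U : set (fpspace R K n)) (fpclass hN).
  by rewrite -DU => i iD; apply: eP iD _ _ _ (lexx e) MN.
by exists U.
Qed.

End Distance.

(** * The gluing construction *)

Section Gluing.
Variables (R : realType) (K : fieldType) (n : nat).
Local Notation pt := 'rV[R]_n.
Local Notation pmod := (pmod R K n).
Local Notation shift := Defs.shift.

(** * Decompositions and idempotents *)

Lemma dsum_projections (A B : pmod) : exists p1 p2 : mor (dsum A B) (dsum A B),
  (forall s v, p1 s v = (v.1, 0)) /\ (forall s v, p2 s v = (0, v.2)).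
Proof.
have [|s t h v|p1 p1E] := @mor_of_linear _ _ _ (dsum A B) (dsum A B)
    (fun s v => (v.1, 0)).
- by move=> s c u v; congr pair; rewrite /= scaler0 addr0.
- by rewrite !dsum_smapE /= linear0.
have [|s t h v|p2 p2E] := @mor_of_linear _ _ _ (dsum A B) (dsum A B)
    (fun s v => (0, v.2)).
- by move=> s c u v; congr pair; rewrite /= scaler0 addr0.
- by rewrite !dsum_smapE /= linear0.
by exists p1, p2.
Qed.

(** A substitute for locality of the endomorphism ring: only idempotents are tested, through their
    scalar on the single vector [x0]. The projections to two summands compose to 0, so one of their
    scalars is 0 and that projection vanishes, although its summand is nonzero. *)
Lemma indecomposable_of_scalar (N : pmod) s0 (x0 : N s0) : x0 != 0 ->
  (forall f : mor N N, (forall s v, f s (f s v) = f s v) ->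
    exists c : K, f s0 x0 = c *: x0 /\ (c = 0 -> forall s v, f s v = 0)) ->
  indecomposable N.
Proof.
move=> x0N0 scal; split; first by exists s0, x0.
move=> [A [B [[sA [vA vA0]] [sB [vB vB0]] [f [g [gf fg]]]]]].
have fK s v : g s (f s v) = v.
  by have := congr1 (fun k : mor N N => k s v) gf; rewrite /= comp_lfunE id_lfunE.
have gK s v : f s (g s v) = v.
  by have := congr1 (fun k : mor (dsum A B) (dsum A B) => k s v) fg;
    rewrite /= comp_lfunE id_lfunE.
have [p1 [p2 [p1E p2E]]] := dsum_projections A B.
pose e1 := mor_comp g (mor_comp p1 f); pose e2 := mor_comp g (mor_comp p2 f).
have e1E s v : e1 s v = g s ((f s v).1, 0) by rewrite /= !comp_lfunE p1E.
have e2E s v : e2 s v = g s (0, (f s v).2) by rewrite /= !comp_lfunE p2E.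
have [|c1 [c1E c10]] := scal e1; first by move=> s v; rewrite !e1E gK.
have [|c2 [c2E c20]] := scal e2; first by move=> s v; rewrite !e2E gK.
have : e1 s0 (e2 s0 x0) = 0 by rewrite e1E e2E gK linear0.
rewrite c2E linearZ /= c1E scalerA => /eqP.
rewrite scaler_eq0 (negPf x0N0) orbF mulf_eq0 => /orP[] /eqP.
  move=> /c20/(_ sB (g sB (0, vB))); rewrite e2E gK /= => /(congr1 (f sB)).
  by rewrite gK linear0 => -[vB'0]; rewrite vB'0 eqxx in vB0.
move=> /c10/(_ sA (g sA (vA, 0))); rewrite e1E gK /= => /(congr1 (f sA)).
by rewrite gK linear0 => -[vA'0]; rewrite vA'0 eqxx in vA0.
Qed.

(** Both sides are components of morphisms from [X] to [X[e][e]], the right one being [eta] followed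
    by its own shift, so agreement on generators suffices. *)
Lemma pres_eta_comp (G Q : finType) (d : G -> pt) (q : Q -> pt)
    (A : Q -> G -> K) (X Y : pmod) (x : forall (g : G) (s : pt), X s)
    (e : R) (e0 : 0 <= e) (f : mor X (shift e Y)) (f' : mor Y (shift e X)) :
  presents d q A x ->
  (forall g s, ple (d g) s -> f' (psh s e) (f s (x g s)) = x g (psh (psh s e) e)) ->
  forall s v, f' (psh s e) (f s v) = smap X (ple_psh2 s e0 e0) v.
Proof.
move=> PX E s v.
have := pres_eq PX (f := mor_comp (mor_shift e f') f)
  (f' := mor_comp (mor_shift e (eta X e0)) (eta X e0)) _ v.
rewrite /= !comp_lfunE /= (smap_compE _ _ (ple_psh2 s e0 e0)); apply=> g t gt.
by rewrite !comp_lfunE /= E // (smap_compE _ _ (ple_psh2 t e0 e0)) (pres_smap PX).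
Qed.

Section Construction.
Variables (i0 i1 : 'I_n) (i10 : i1 != i0) (e : R) (e0 : 0 < e).
Variables (G Q : finType) (d : G -> pt) (q : Q -> pt) (A : Q -> G -> K).
Hypothesis deg : forall k g, A k g != 0 -> ple (d g) (q k).
Variables (th dl : G -> R) (lo hi : R).
Local Notation a g := (d g ord0 i0 + th g).
Hypothesis th_ge0 : forall g, 0 <= th g.
Hypothesis th_lt : forall g, th g < e.
Hypothesis a_inj : injective (fun g => a g).
Hypothesis lo_lt : forall g, lo < a g - e.
Hypothesis lt_hi : forall g i, d g ord0 i + th g < hi - e.
Hypothesis dl_gt0 : forall g, 0 < dl g.
Hypothesis dl_le : forall g, dl g <= e.
Hypothesis dl_mono : forall g g', dl g' <= dl g -> a g' <= a g.

Definition glue_pt (u v w : R) : pt :=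
  \row_i (if i == i0 then u else if i == i1 then v else w).

(* The generators are those of the given presentation ([inl g]), one bridge
   [inr (Some g)] for each of them, and the common far generator [inr None]. *)
Definition glue_gen (u : G + option G) : pt :=
  match u with
  | inl g => psh (d g) (th g)
  | inr (Some g) => glue_pt (a g - e) (hi - dl g) hi
  | inr None => glue_pt lo hi hi
  end.

(** Raising the old relations by the full [e] keeps them above generators raised by less than [e].
    The bridge relation of [g] lies on the hyperplane where the moved generator [g] is born; the
    last relation makes the far generator die after a shift by [e]. *)
Definition glue_rel (k : Q + option G) : pt :=
  match k with
  | inl k => psh (q k) e
  | inr (Some g) => glue_pt (a g) hi hi
  | inr None => psh (glue_pt lo hi hi) e
  end.

Definition glue_mx (k : Q + option G) (u : G + option G) : K :=
  match k, u with
  | inl k, inl g => A k g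
  | inl _, inr _ => 0
  | inr (Some g), inl g' => - (g' == g)%:R
  | inr (Some g), inr (Some g') => (g' == g)%:R
  | inr (Some _), inr None => -1
  | inr None, inr None => 1
  | inr None, _ => 0
  end.

Lemma plei s t (i : 'I_n) : ple (s : pt) t -> s ord0 i <= t ord0 i.
Proof. by move=> /forallP. Qed.

Lemma glue_pt0 u v w : glue_pt u v w ord0 i0 = u.
Proof. by rewrite mxE eqxx. Qed.

Lemma glue_pt1 u v w : glue_pt u v w ord0 i1 = v.
Proof. by rewrite mxE (negPf i10) eqxx. Qed.

Lemma pshE (s : pt) r i : psh s r ord0 i = s ord0 i + r.
Proof. by rewrite !mxE. Qed.

Lemma glue_ptP (s : pt) u v w : s ord0 i0 <= u -> s ord0 i1 <= v ->
  (forall i, s ord0 i <= w) -> ple s (glue_pt u v w).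
Proof.
move=> s0 s1 sw; apply/forallP => i; rewrite mxE.
by case: eqP => [->//|_]; case: eqP => [->|_].
Qed.

Lemma glue_gen_gen g : ple (glue_gen (inl g)) (glue_pt (a g) hi hi).
Proof.
apply: glue_ptP => [||i]; rewrite /= pshE //.
  by move: e0 (lt_hi g i1); lra.
by move: e0 (lt_hi g i); lra.
Qed.

Lemma glue_gen_bridge g : ple (glue_gen (inr (Some g))) (glue_pt (a g) hi hi).
Proof.
have := dl_gt0 g; have := dl_le g; have := e0 => ? ? ?.
apply: glue_ptP => [||i]; rewrite /= ?glue_pt0 ?glue_pt1; try lra.
rewrite mxE; have := lt_hi g i0; do 2?case: ifP => _; lra.
Qed.

Lemma glue_gen_far g : ple (glue_gen (inr None)) (glue_pt (a g) hi hi).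
Proof.
have := lo_lt g; have := e0 => ? ?.
apply: glue_ptP => [||i]; rewrite /= ?glue_pt0 ?glue_pt1; try lra.
rewrite mxE; have := lt_hi g i0; do 2?case: ifP => _; lra.
Qed.

Lemma glue_deg k u : glue_mx k u != 0 -> ple (glue_gen u) (glue_rel k).
Proof.
case: k => [k|[g|]]; case: u => [g'|[g'|]] //=; rewrite ?eqxx //.
- move=> /deg gk; apply/forallP => i; rewrite !pshE.
  by have := plei i gk; have := th_lt g'; lra.
- by case: (eqVneq g' g) => [-> _|]; [exact: glue_gen_gen | rewrite oppr0 eqxx].
- by case: (eqVneq g' g) => [-> _|]; [exact: glue_gen_bridge | rewrite eqxx].
- by move=> _; exact: glue_gen_far.
- by move=> _; rewrite ple_psh0 // ltW.
Qed.

Lemma glue_sum (V : lmodType K) k (y : G + option G -> V) :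
  \sum_u glue_mx k u *: y u =
  match k with
  | inl k => \sum_g A k g *: y (inl g)
  | inr (Some g) => y (inr (Some g)) - y (inl g) - y (inr None)
  | inr None => y (inr None)
  end.
Proof.
rewrite big_sumType /=.
have optE (F : option G -> V) : \sum_u F u = F None + \sum_g F (Some g).
  rewrite (bigD1 None) //=; congr (_ + _).
  rewrite (reindex_omap Some id) /=; last by case.
  by apply: eq_bigl => g; rewrite eqxx.
rewrite optE.
have d0 (g : G) (z : G -> V) : \sum_g' (g' == g)%:R *: z g' = z g.
  rewrite (bigD1 g) //= eqxx scale1r big1 ?addr0 // => g' /negPf ->.
  by rewrite scale0r.
case: k => [k|[g|]] /=.
- by rewrite scale0r add0r [X in _ + X]big1 ?addr0 // => g _; rewrite scale0r.
- rewrite d0 scaleN1r; under eq_bigr do rewrite scaleNr.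
  by rewrite sumrN d0 [X in _ + X]addrC addrCA addrA.
- rewrite scale1r !big1 ?add0r ?addr0 // => g _; exact: scale0r.
Qed.

(** * Interleaving of the glued module with the given one *)

Variables (N : pmod) (y : forall (u : G + option G) (s : pt), N s).
Hypothesis PN : presents glue_gen glue_rel glue_mx y.

Lemma glue_interleaved (M : pmod) (x : forall (g : G) (s : pt), M s) :
  presents d q A x -> interleaved e M N.
Proof.
move=> PM; have ge0 := ltW e0.
have gen_le g s : ple (d g) s -> ple (glue_gen (inl g)) (psh s e).
  move=> gs; apply/forallP => i; rewrite /= !pshE.
  by have := plei i gs; have := th_lt g; lra.
have le_gen g s : ple (glue_gen (inl g)) s -> ple (d g) (psh s e).
  move=> gs; apply/forallP => i; rewrite /= !pshE.
  by have := plei i gs; rewrite /= pshE; have := th_ge0 g; lra.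
have le_bridge g s : ple (glue_gen (inr (Some g))) s ->
    ple (glue_pt (a g) hi hi) (psh s e).
  move=> gs; apply/forallP => i; rewrite /= !pshE.
  have := plei i gs; rewrite !mxE; have := dl_le g.
  by case: ifP => // _; try case: ifP => // _; lra.
have [||f fE] := pres_hom PM (Y := shift e N) (y := fun g s => y (inl g) (psh s e)).
- by move=> g s t h gs; rewrite /= (pres_smap PN) // gen_le.
- move=> k s ks; rewrite -[RHS](pres_rel PN (k := inl k) (s := psh s e)) ?glue_sum //=.
  exact: ple_psh.
(* Going back to [M], a bridge is identified with its generator and the far generator is sent to 0,
   which respects the bridge relation. *)
pose z (u : G + option G) s : shift e M s :=
  match u with inl g | inr (Some g) => x g (psh s e) | inr None => 0 end.
have le_bridge' g s : ple (glue_gen (inr (Some g))) s -> ple (d g) (psh s e).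
  move=> /le_bridge; apply: ple_trans; apply: ple_trans (glue_gen_gen g).
  exact: ple_psh0.
have [||f' f'E] := pres_hom PN (Y := shift e M) (y := z).
- move=> [g|[g|]] s t h gs /=; last exact: linear0.
    by rewrite (pres_smap PM) //; apply: le_gen.
  by rewrite (pres_smap PM) //; apply: le_bridge'.
- move=> k s ks; rewrite (glue_sum k (z^~ s)); case: k ks => [k|[g|]] //= ks.
    apply: (pres_rel PM); apply: ple_trans (ple_psh0 _ ge0); apply: ple_trans ks.
    exact: ple_psh0.
  by rewrite subrr sub0r oppr0.
exists ge0, f, f'; split; apply/eta_compP => s v.
- move: s v.
  apply: (@pres_eta_comp _ _ _ _ _ _ _ _ _ ge0 f f' PM) => g s gs; rewrite fE //.
  exact: (f'E (inl g) (psh s e) (gen_le _ _ gs)).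
- move: s v.
  apply: (@pres_eta_comp _ _ _ _ _ _ _ _ _ ge0 f' f PN) => u s us; rewrite f'E //.
  case: u us => [g|[g|]] /= us.
  - by rewrite fE // le_gen.
  - rewrite fE ?le_bridge' //.
    (* After a shift by [2e] the bridge relation holds and the far generator is dead, so the bridge
       equals its generator there. *)
    have ks : ple (glue_pt (a g) hi hi) (psh (psh s e) e).
      by apply: ple_trans (le_bridge _ _ us) _; apply: ple_psh0.
    have := pres_rel PN (k := inr (Some g)) ks.
    have := pres_rel PN (k := inr None) (s := psh (psh s e) e).
    rewrite !glue_sum /= => ->; last first.
      apply: ple_psh; apply: ple_trans (le_bridge _ _ us); exact: glue_gen_far.
    by rewrite subr0 => /eqP; rewrite subr_eq0 => /eqP ->.
  - rewrite linear0; apply/esym.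
    have := pres_rel PN (k := inr None) (s := psh (psh s e) e).
    rewrite glue_sum /=; apply; apply: ple_psh; apply: ple_trans us _.
    exact: ple_psh0.
Qed.

(** The relations that involve the far generator have [i0]-coordinate [a g] or [lo + e], both larger
    than [lo], so none of them is present at its degree. *)
Lemma glue_far_neq0 : y (inr None) (glue_gen (inr None)) != 0.
Proof.
apply/eqP => y0.
have [|b bE] := pres_syz PN (s := glue_gen (inr None)) (c := fun u => (u == inr None)%:R).
  rewrite big1 // => u _; case: eqVneq => [->|_]; last by rewrite scale0r.
  by rewrite y0 scaler0.
have := bE (inr None) (ple_refl _); rewrite eqxx big1 => [/eqP|].
  by rewrite oner_eq0.
move=> [k|[g|]] ks /=; first by rewrite mulr0.
  exfalso; have := plei i0 ks; have := lo_lt g; have := e0.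
  by rewrite /= !glue_pt0; lra.
by exfalso; have := plei i0 ks; have := e0; rewrite /= pshE !glue_pt0; lra.
Qed.

(** * Endomorphisms of the glued module *)

Lemma glue_nle_bridge_gen g g' : ~ ple (glue_gen (inr (Some g))) (glue_gen (inl g')).
Proof.
move=> /(plei i1); rewrite /= glue_pt1 pshE.
by have := lt_hi g' i1; have := dl_le g; lra.
Qed.

Lemma glue_nle_far_gen g : ~ ple (glue_gen (inr None)) (glue_gen (inl g)).
Proof.
move=> /(plei i1); rewrite /= glue_pt1 pshE.
by have := lt_hi g i1; have := e0; lra.
Qed.

Lemma glue_le_far u : ple (glue_gen u) (glue_gen (inr None)) -> u = inr None.
Proof.
case: u => [g|[g|]] // /(plei i0); rewrite /= ?pshE !glue_pt0 => h; exfalso;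
  by have := lo_lt g; have := e0; lra.
Qed.

Lemma glue_nle_far_bridge g : ~ ple (glue_gen (inr None)) (glue_gen (inr (Some g))).
Proof. by move=> /(plei i1); rewrite /= !glue_pt1; have := dl_gt0 g; lra. Qed.

(** As [dl] increases with [a], a bridge farther along [i0] starts lower along [i1]; comparable
    bridges thus have equal [a]. *)
Lemma glue_le_bridge g g' :
  ple (glue_gen (inr (Some g'))) (glue_gen (inr (Some g))) -> g' = g.
Proof.
move=> h; have := plei i0 h; have := plei i1 h; rewrite /= !glue_pt0 !glue_pt1.
move=> h1 h0; apply: a_inj; apply: le_anti; apply/andP; split; first by lra.
by apply: dl_mono; lra.
Qed.

Lemma glue_gen_le_bridge g g' :
  ple (glue_gen (inl g')) (glue_gen (inr (Some g))) -> a g' < a g.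
Proof. by move=> /(plei i0); rewrite /= pshE glue_pt0; have := e0; lra. Qed.

Lemma glue_gen_le g g' : ple (glue_gen (inl g')) (glue_gen (inl g)) ->
  g' != g -> a g' < a g.
Proof.
move=> /(plei i0); rewrite /= !pshE => h; rewrite lt_neqAle h andbT.
by apply: contraNneq => /a_inj ->.
Qed.

(** At the degree of the bridge relation of [g], the only relation that can contribute to the
    coefficients of the far generator and of [g] is that bridge relation itself, so both are fixed
    by the coefficient of the bridge. *)
Lemma glue_syz g (D : G + option G -> K) :
  (forall u, D u != 0 -> ple (glue_gen u) (glue_pt (a g) hi hi)) ->
  \sum_u D u *: y u (glue_pt (a g) hi hi) = 0 ->
  (forall g', g' != g -> D (inr (Some g')) = 0) ->
  D (inr None) = - D (inr (Some g)) /\ D (inl g) = - D (inr (Some g)).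
Proof.
set t := glue_pt _ _ _ => Dt; rewrite -(sum_supp _ Dt) => /(pres_syz PN)[b bE] D0.
pose B k := if ple (glue_rel k) t then b k else 0.
have {}bE u : ple (glue_gen u) t -> D u = \sum_k B k * glue_mx k u.
  move=> /bE ->; rewrite big_mkcond; apply: eq_bigr => k _ /=.
  by rewrite /B; case: ifP; rewrite ?mul0r.
(* The relation killing the far generator has [i1]-coordinate [hi + e], beyond [t]. *)
have BN : B (inr None) = 0.
  rewrite /B; case: ifP => // /(plei i1); rewrite pshE !glue_pt1 => h.
  by exfalso; have := e0; lra.
have sumE u : ple (glue_gen u) t -> D u = \sum_k B (inl k) * glue_mx (inl k) u +
    \sum_g' B (inr (Some g')) * glue_mx (inr (Some g')) u.
  move=> /bE ->; rewrite big_sumType /=; congr (_ + _).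
  rewrite (bigD1 None) //= BN mul0r add0r.
  rewrite (reindex_omap Some id) /=; last by case.
  by apply: eq_bigl => g'; rewrite eqxx.
(* The bridge of [g'] occurs in its own bridge relation only. *)
have DB g' : ple (glue_gen (inr (Some g'))) t -> D (inr (Some g')) = B (inr (Some g')).
  move=> /sumE -> /=; rewrite big1 ?add0r => [|k _]; last by rewrite mulr0.
  rewrite (bigD1 g') //= eqxx mulr1 big1 ?addr0 // => g'' /negPf.
  by rewrite eq_sym => ->; rewrite mulr0.
have B0 g' : g' != g -> B (inr (Some g')) = 0.
  move=> g'g; rewrite /B; case: ifP => // h.
  have := DB g' (ple_trans (glue_gen_bridge g') h).
  by rewrite D0 // /B h.
rewrite (DB g (glue_gen_bridge g)); split.
  rewrite (sumE _ (glue_gen_far g)) /= big1 ?add0r => [|k _]; last by rewrite mulr0.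
  rewrite (bigD1 g) //= mulrN1 big1 ?addr0 // => g' g'g.
  by rewrite B0 // mul0r.
rewrite (sumE _ (glue_gen_gen g)) /= big1 ?add0r => [|k _].
  rewrite (bigD1 g) //= eqxx mulrN1 big1 ?addr0 // => g' g'g.
  by rewrite B0 // mul0r.
(* An old relation involving [g] has [i0]-coordinate at least that of [d g] plus [e], which exceeds
   [a g] because [th g < e]; it is not present at [t]. *)
rewrite /B; case: ifP => [h|_]; last by rewrite mul0r.
case: (eqVneq (A k g) 0) => [->|/deg /(plei i0)]; first by rewrite mulr0.
move=> h'; exfalso; move: h' (plei i0 h) (th_lt g).
by rewrite /= pshE glue_pt0; lra.
Qed.

Lemma glue_idempotent (f : mor N N) : (forall s v, f s (f s v) = f s v) ->
  exists c : K, f _ (y (inr None) (glue_gen (inr None))) =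
      c *: y (inr None) (glue_gen (inr None)) /\
    (c = 0 -> forall s v, f s v = 0).
Proof.
move=> ff; have [C [CP fE]] := pres_endo PN f.
have C0 u u' : ~ ple (glue_gen u') (glue_gen u) -> C u u' = 0.
  by move=> h; case: (eqVneq (C u u') 0) => // /CP.
have Cbb g g' : g' != g -> C (inr (Some g)) (inr (Some g')) = 0.
  by move=> gg'; apply: C0 => /glue_le_bridge h; rewrite h eqxx in gg'.
have Cgb g g' : C (inl g) (inr (Some g')) = 0.
  by apply: C0; apply: glue_nle_bridge_gen.
have Cgf g : C (inl g) (inr None) = 0 by apply: C0; apply: glue_nle_far_gen.
have Cf u : u != inr None -> C (inr None) u = 0.
  by move=> uN; apply: C0 => /glue_le_far uE; rewrite uE eqxx in uN.
have Cbf g : C (inr (Some g)) (inr None) = 0.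
  by apply: C0; apply: glue_nle_far_bridge.
have Cbg g : C (inr (Some g)) (inl g) = 0.
  by apply: C0 => /glue_gen_le_bridge; rewrite ltxx.
have diag g : C (inl g) (inl g) = C (inr None) (inr None) /\
    C (inr (Some g)) (inr (Some g)) = C (inr None) (inr None).
  pose t := glue_pt (a g) hi hi.
  (* These are the coefficients of the image under [f] of the bridge relation of [g], which is again
     0. *)
  pose D u := C (inr (Some g)) u - C (inl g) u - C (inr None) u.
  have [u|||] := @glue_syz g D.
  - move=> Du.
    have : [|| C (inr (Some g)) u != 0, C (inl g) u != 0 | C (inr None) u != 0].
      apply: contraNT Du; rewrite !negb_or !negbK => /and3P[/eqP H1 /eqP H2 /eqP H3].
      by rewrite /D H1 H2 H3 !subr0.
    move=> /or3P[] /CP /ple_trans; apply.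
    + exact: glue_gen_bridge.
    + exact: glue_gen_gen.
    + exact: glue_gen_far.
  - under eq_bigr do rewrite /D !scalerBl.
    rewrite !sumrB -!fE ?glue_gen_bridge ?glue_gen_gen ?glue_gen_far //.
    rewrite -!linearB /= -(glue_sum (inr (Some g)) (y^~ t)).
    by rewrite (pres_rel PN) ?linear0 // ple_refl.
  - by move=> g' g'g; rewrite /D Cbb // Cgb Cf // !subr0.
  rewrite /D Cbf Cgf Cbg Cgb !(Cf (inr (Some _))) // (Cf (inl _)) // !subr0 !sub0r.
  by move=> /oppr_inj <- /oppr_inj.
exists (C (inr None) (inr None)); split=> [|c0].
  rewrite fE ?ple_refl // (bigD1 (inr None)) //= big1 ?addr0 // => u uN.
  by rewrite Cf // scale0r.
(* Applying [f] twice expresses [f] on [u] by its values on the generators occurring in the image of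
   [u]; when the diagonal scalar is 0, the term of [u] itself drops out. *)
have idem u s : ple (glue_gen u) s ->
    f s (y u s) = \sum_u' C u u' *: f s (y u' s).
  move=> us; rewrite -ff fE // linear_sum.
  by apply: eq_bigr => u' _; rewrite linearZ.
have fg g s : ple (glue_gen (inl g)) s -> f s (y (inl g) s) = 0.
  (* Induction on the number of generators with smaller [a]: with zero diagonal, only those can
     occur in the image of [g]. *)
  have [m] := ubnP #|[pred g' | a g' < a g]|; elim: m g => // m IH g cardg gs.
  rewrite idem // big1 // => u _.
  case: (eqVneq (C (inl g) u) 0) => [->|Cu]; first by rewrite scale0r.
  case: u Cu => [g'|[g'|]]; rewrite ?Cgb ?Cgf ?eqxx // => Cu.
  have g'g : a g' < a g.
    apply: glue_gen_le (CP _ _ Cu) _; apply: contraNneq Cu => ->.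
    by rewrite (proj1 (diag g)) c0.
  rewrite IH ?scaler0 //; last exact: ple_trans (CP _ _ Cu) gs.
  move: cardg; rewrite ltnS; apply: leq_trans; apply: proper_card; apply/properP; split.
    by apply/fintype.subsetP => g''; rewrite !inE => /lt_trans; apply.
  by exists g'; rewrite !inE // ltxx.
have f0 u s : ple (glue_gen u) s -> f s (y u s) = 0.
  case: u => [g|[g|]] us; first exact: fg.
    rewrite idem // big1 // => u _.
    case: (eqVneq (C (inr (Some g)) u) 0) => [->|Cu]; first by rewrite scale0r.
    (* A bridge maps to its diagonal term, which is 0 here, plus old generators, already known to be
       killed. *)
    case: u Cu => [g'|[g'|]] Cu.
    - by rewrite fg ?scaler0 // (ple_trans (CP _ _ Cu) us).
    - case: (eqVneq g' g) => [gE|/Cbb Cg]; last by rewrite Cg scale0r.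
      by rewrite gE (proj2 (diag g)) c0 scale0r.
    - by rewrite Cbf eqxx in Cu.
  rewrite idem // big1 // => u _.
  case: (eqVneq u (inr None)) => [->|uN]; first by rewrite c0 scale0r.
  by rewrite Cf // scale0r.
move=> s v; rewrite (pres_eq PN (f := f) (f' := mor_zero N N)) /= ?zero_lfunE //.
by move=> u t ut; rewrite f0 //= zero_lfunE.
Qed.

Lemma glue_indecomposable : indecomposable N.
Proof. exact: indecomposable_of_scalar glue_far_neq0 glue_idempotent. Qed.

End Construction.

(** * Choice of the parameters and density *)

Lemma avoid_seq (L : seq R) (e : R) : 0 < e -> exists2 t, 0 < t < e & t \notin L.
Proof.
elim: L e => [|u L IH] e e0; first by exists (e / 2); rewrite ?in_nil //; lra.
(* A positive [u] is avoided by staying below it; a nonpositive one is avoided because [t] is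
   positive. *)
have m0 : 0 < (if 0 < u then Num.min u e else e) by case: ifP; rewrite ?lt_min => // ->.
have [t /andP[t0 tm] tL] := IH _ m0; exists t.
  by rewrite t0 (lt_le_trans tm) //; case: ifP => // _; rewrite ge_min lexx orbT.
rewrite inE negb_or tL andbT; apply: contraTneq tm => <-.
by rewrite t0 -leNgt ge_min lexx.
Qed.

Lemma separate_points (G : finType) (u : G -> R) (e : R) : 0 < e ->
  exists2 th : G -> R, (forall g, 0 <= th g < e) & injective (fun g => u g + th g).
Proof.
move=> e0; suff [th thP th_inj] : exists2 th : G -> R, (forall g, 0 <= th g < e) &
    {in enum G &, injective (fun g => u g + th g)}.
  by exists th => // g g'; apply: th_inj; rewrite mem_enum.
elim: (enum G) => [|g0 r [th thP th_inj]]; first by exists (fun=> 0); rewrite // lexx.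
(* The listed differences are exactly the perturbations of [g0] that would collide with a point
   already placed. *)
have [t /andP[t0 te] tL] := avoid_seq [seq u g + th g - u g0 | g <- r] e0.
have tN g : g \in r -> u g + th g <> u g0 + t.
  move=> gr E; move/negP: tL; apply; apply/mapP; exists g => //.
  by rewrite E addrAC subrr add0r.
(* The induction does not record that the enumeration is duplicate-free; a repeated point keeps its
   perturbation. *)
have [g0r|g0r] := boolP (g0 \in r).
  exists th => // g g'; rewrite !inE => gr g'r; apply: th_inj.
    by case/orP: gr => // /eqP ->.
  by case/orP: g'r => // /eqP ->.
have g0E g : g \in r -> (g == g0) = false.
  by move=> gr; apply: contraNF g0r => /eqP <-.
exists (fun g => if g == g0 then t else th g).
  by move=> g; case: eqP => // _; rewrite ltW.
move=> g g'; rewrite !inE => /orP[/eqP ->|gr] /orP[/eqP ->|g'r] //=.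
- by rewrite eqxx g0E // => /esym /tN; case.
- by rewrite eqxx g0E // => /tN; case.
- by rewrite !g0E //; apply: th_inj.
Qed.

Lemma indecomposable_approx (M : pmod) (e : R) : (2 <= n)%N -> 0 < e ->
  finitely_presentable M ->
  exists N : pmod, [/\ finitely_presentable N, indecomposable N & interleaved e M N].
Proof.
move=> n2 e0 /finitely_presentable_presents[G [Q [d [q [A [x PM]]]]]].
pose i0 : 'I_n := Ordinal (ltnW n2); pose i1 : 'I_n := Ordinal n2.
have i10 : i1 != i0 by [].
have [th thP a_inj] := separate_points (fun g => d g ord0 i0) e0.
have th_ge0 g : 0 <= th g by case/andP: (thP g).
have th_lt g : th g < e by case/andP: (thP g).
pose C := \sum_g \sum_i `|d g ord0 i|.
have dC g i : `|d g ord0 i| <= C.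
  rewrite /C (bigD1 g) //= (bigD1 i) //= -addrA lerDl addr_ge0 ?sumr_ge0 // => g' _.
  exact: sumr_ge0.
have C0 : 0 <= C by apply: sumr_ge0 => g _; apply: sumr_ge0.
(* All [a g] lie in [[-C, C + e)], so these bounds leave a margin of more than [e] on both sides. *)
pose lo := - C - 2 * e; pose hi := C + 3 * e.
have lo_lt g : lo < d g ord0 i0 + th g - e.
  have := dC g i0; have := th_ge0 g; rewrite ler_norml /lo => ? /andP[? ?].
  by lra.
have lt_hi g i : d g ord0 i + th g < hi - e.
  have := dC g i; have := th_lt g; rewrite ler_norml /hi => ? /andP[? ?].
  by lra.
(* With this slope, the increasing affine function [dl] of [a] maps the interval from [lo] to [hi]
   onto that from 0 to [e]. *)
pose c := e / (hi - lo).
have lohi : 0 < hi - lo by rewrite /hi /lo; lra.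
have c0 : 0 < c by rewrite divr_gt0.
pose dl g := c * (d g ord0 i0 + th g - lo).
have dl_gt0 g : 0 < dl g by rewrite mulr_gt0 //; have := lo_lt g; lra.
have dl_le g : dl g <= e.
  rewrite -[leRHS](divfK (lt0r_neq0 lohi)) -/c ler_pM2l //.
  by have := lt_hi g i0; lra.
have dl_mono g g' : dl g' <= dl g -> d g' ord0 i0 + th g' <= d g ord0 i0 + th g.
  by rewrite ler_pM2l // lerD2r.
have degN := @glue_deg i0 i1 i10 e e0 G Q d q A (pres_deg PM) th dl lo hi
  th_lt lo_lt lt_hi dl_gt0 dl_le.
have [N [y [fpN PN]]] := presentation_exists degN.
exists N; split=> //.
  exact: (glue_indecomposable i10 e0 (pres_deg PM) th_lt a_inj lo_lt lt_hi dl_gt0 dl_le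
    dl_mono PN).
exact: (glue_interleaved i10 e0 th_ge0 th_lt lo_lt lt_hi dl_le PN PM).
Qed.

End Gluing.

Theorem theoremA (R : realType) (K : fieldType) (n : nat) (hn : (2 <= n)%N) :
  dense (@fp_indecomposable R K n : set (fpspace R K n)).
Proof.
move=> O [z Oz] openO; have [M [hM zE]] := fpclass_surj z.
rewrite zE in Oz; have [e e0 eO] := fp_open_ball openO Oz.
have [N [hN indN MN]] := indecomposable_approx hn e0 hM.
by exists (fpclass hN); split; [exact: eO | exists N, hN].
Qed.
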